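(* Let $\Gamma$ be a group, let $\mathcal M=(B,D,d)$ be an abelian $\Gamma$-crossed module, let $Q$ be a $\Gamma$-module and let $\psi:Q\to\mathrm{Coker}\,d$ be a $\Gamma$-module homomorphism. There exists a bijection $$\Omega:\mathrm{Hom}_{(\psi,0)}[\mathrm{Dis}_{\Gamma,s}Q,\mathbb G_{\mathcal M}]\longrightarrow\mathrm{Ext}^{\mathcal M}_{\mathbb Z\Gamma}(Q,B,\psi)$$ between the set of homotopy classes of graded symmetric monoidal functors $\mathrm{Dis}_{\Gamma,s}Q\to\mathbb G_{\mathcal M}$ inducing the pair $(\psi,0)$ and the set of equivalence classes of $\Gamma$-module extensions of $B$ by $Q$ of type $\mathcal M$ inducing $\psi$.
   Context: All groups $B,D,Q$ here are abelian and written additively. An abelian $\Gamma$-crossed module $\mathcal M=(B,D,d)$ is a homomorphism $d:B\to D$ of $\Gamma$-modules (with $D$ acting trivially on $B$ and zero braiding map). A homomorphism $(f_1,f_0):(B,D,d)\to(B',D',d')$ of abelian $\Gamma$-crossed modules is a pair of $\Gamma$-module homomorphisms with $f_0d=d'f_1$. **Extensions of type $\mathcal M$.** A $\Gamma$-module extension $\mathcal E_{d,Q}$ of $B$ by $Q$ of type $\mathcal M$ is a short exact sequence of $\Gamma$-modules $0\to B\xrightarrow{j}E\xrightarrow{p}Q\to0$ together with a $\Gamma$-module homomorphism $\varepsilon:E\to D$ with $\varepsilon j=d$ (i.e. $(id,\varepsilon):(B\xrightarrow{j}E)\to(B\xrightarrow{d}D)$ is a homomorphism of abelian $\Gamma$-crossed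 modules). Two such extensions $(E,j,p,\varepsilon)$, $(E',j',p',\varepsilon')$ are equivalent if there is a $\Gamma$-module homomorphism $\alpha:E\to E'$ with $\alpha j=j'$, $p'\alpha=p$, $\varepsilon'\alpha=\varepsilon$. With $q:D\to\mathrm{Coker}\,d$ the projection, the extension induces the unique $\Gamma$-module homomorphism $\psi:Q\to\mathrm{Coker}\,d$ with $\psi p=q\varepsilon$. $\mathrm{Ext}^{\mathcal M}_{\mathbb Z\Gamma}(Q,B,\psi)$ is the set of equivalence classes of extensions of type $\mathcal M$ inducing $\psi$. **Graded categories.** Regard $\Gamma$ as a one-object category. A grading on a category is a functor $gr$ to $\Gamma$. A $\Gamma$-graded Picard category is a groupoid $\mathbb G$ with a grading that is stable (each object is the domain of isomorphisms of every grade), grade-preserving functors $\otimes:\mathbb G\times_\Gamma\mathbb G\to\mathbb G$ (defined on pairs of morphisms of equal grade) and $I:\Gamma\to\mathbb G$, and natural constraints $\mathbf a,\mathbf l,\mathbf r,\mathbf c$ of grade $1$ satisfying the usual axioms of a symmetric monoidal category, such that every object $X$ has an $X'$ with a grade-1 morphism $X\otimes X'\to I$. A graded symmetric monoidal functor $(F,\widetilde F,F_* )$ is a grade-preserving functor $F$ with natural isomorphisms of grade 1 $\widetilde F_{X,Y}:FX\otimes FY\to F(X\otimes Y)$ and an isomorphism of grade 1 $F_*:I'\to FI$ satisfying the usual compatibilities with associativity, unit and symmetry constraints. Two graded symmetric monoidal functors $F,F'$ are homotopic if there is a graded natural equivalence $\theta:F\to F'$ (components of grade 1, natural for all morphisms)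 with $\widetilde F'_{X,Y}(\theta_X\otimes\theta_Y)=\theta_{X\otimes Y}\widetilde F_{X,Y}$ and $\theta_IF_*=F'_*$. **$\mathbb G_{\mathcal M}$:** objects are the elements of $D$; a morphism $x\to y$ of grade $\sigma$ is a pair $(b,\sigma)$, $b\in B$, with $\sigma x=d(b)+y$; the composite of $(b,\sigma):x\to y$ followed by $(c,\tau):y\to z$ is $(\tau b+c,\tau\sigma)$; $x\otimes y=x+y$, $(b,\sigma)\otimes(c,\sigma)=(b+c,\sigma)$; all constraints are identities; $I(\sigma)=(0,\sigma):0\to0$. **$\mathrm{Dis}_{\Gamma,s}Q$:** the graded Picard category $\mathbb G_{(0,Q,0)}$: objects are the elements of $Q$, and there is exactly one morphism $(0,\sigma):u\to v$ of grade $\sigma$ if $\sigma u=v$ and none otherwise; $\otimes$ is addition and all constraints are identities. A graded symmetric monoidal functor $F:\mathrm{Dis}_{\Gamma,s}Q\to\mathbb G_{\mathcal M}$ induces the pair $(\psi,0):(Q,0)\to(\mathrm{Coker}\,d,\mathrm{Ker}\,d)$ if $q(F(u))=\psi(u)$ for all $u\in Q$. $\mathrm{Hom}_{(\psi,0)}[\mathrm{Dis}_{\Gamma,s}Q,\mathbb G_{\mathcal M}]$ is the set of homotopy classes of such functors. *)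

(* Defs.v *)
From HB Require Import structures.
From mathcomp Require Import all_boot all_algebra.
From mathcomp Require Import boolp.

Set Implicit Arguments.
Unset Strict Implicit.
Unset Printing Implicit Defensive.

Import GRing.Theory.

Declare Scope gcat_scope.
Delimit Scope gcat_scope with gcat.

Local Open Scope ring_scope.
Local Open Scope quotient_scope.
#[local] Obligation Tactic := idtac.

Reserved Notation "s ** x" (at level 40, left associativity).
Reserved Notation "f ;; g" (at level 50, left associativity).
Reserved Notation "{ 'gmodhom' A -> B }"
  (A at level 98, B at level 99, format "{ 'gmodhom'  A  ->  B }").
Reserved Notation "x :*: y" (at level 40, left associativity).

(** The set of classes of an equivalence relation, the class of [x] being the
    predicate [R x].  The quotients [{eq_quot _}] are unavailable here: they
    need a [choiceType], but the extensions of B by Q form a type of a higher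
    universe than the carriers of the algebraic structures. *)
Definition classes (T : Type) (R : T -> T -> Prop) : Type :=
  {P : T -> Prop | exists x, P = R x}.

Definition is_equivalence (T : Type) (R : T -> T -> Prop) : Prop :=
  [/\ forall x, R x x, forall x y, R x y -> R y x
    & forall x y z, R x y -> R y z -> R x z].

HB.mixin Record Zmodule_isGModule (G : groupType) V of GRing.Zmodule V := {
  gact : G -> V -> V;
  gact1 : forall x, gact 1%g x = x;
  gactM : forall s t x, gact (s * t)%g x = gact s (gact t x);
  gactD : forall s x y, gact s (x + y) = gact s x + gact s y
}.

#[short(type="gmodType")]
HB.structure Definition GModule (G : groupType) :=
  {V of GRing.Zmodule V & Zmodule_isGModule G V}.

Notation "s ** x" := (gact s x) : ring_scope.

Section GModuleTheory.
Variables (G : groupType) (V : gmodType G).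

Lemma gact0 (s : G) : s ** (0 : V) = 0.
Proof. by apply: (addrI (s ** (0 : V))); rewrite -gactD !addr0. Qed.

Lemma gactN (s : G) (x : V) : s ** (- x) = - (s ** x).
Proof. by apply: (addrI (s ** x)); rewrite -gactD !subrr gact0. Qed.

End GModuleTheory.

HB.mixin Record isEquivariant (G : groupType) (A B : gmodType G)
    (f : A -> B) := {
  gactE : forall s x, f (s ** x) = s ** f x
}.

HB.structure Definition GHom (G : groupType) (A B : gmodType G) :=
  {f of isEquivariant G A B f & @GRing.Additive A B f}.

Notation "{ 'gmodhom' A -> B }" := (@GHom.type _ A%type B%type) : type_scope.

Section GHomOps.
Variables (G : groupType) (A B C : gmodType G).

Fact id_equivariant (s : G) (x : A) : idfun (s ** x) = s ** idfun x.
Proof. by []. Qed.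
HB.instance Definition _ := isEquivariant.Build G A A idfun id_equivariant.

Fact comp_equivariant (g : {gmodhom B -> C}) (f : {gmodhom A -> B}) (s : G) (x : A) :
  (g \o f) (s ** x) = s ** (g \o f) x.
Proof. by rewrite /= !gactE. Qed.
HB.instance Definition _ (g : {gmodhom B -> C}) (f : {gmodhom A -> B}) :=
  isEquivariant.Build G A C (g \o f) (comp_equivariant g f).

Fact zero_equivariant (s : G) (x : A) :
  (fun=> 0 : B) (s ** x) = s ** (fun=> 0 : B) x.
Proof. by rewrite /= gact0. Qed.
Fact zero_zmod_morphism : zmod_morphism (fun _ : A => 0 : B).
Proof. by move=> x y; rewrite subr0. Qed.
Definition gzero (x : A) : B := 0.
HB.instance Definition _ := GRing.isZmodMorphism.Build A B gzero
  zero_zmod_morphism.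
HB.instance Definition _ := isEquivariant.Build G A B gzero zero_equivariant.

End GHomOps.

Definition zero_gmod (G : groupType) : Type := unit.

Section ZeroModule.
Variable G : groupType.
Local Notation Z := (zero_gmod G).
HB.instance Definition _ := Choice.on Z.

Fact zgm_addA : associative (fun _ _ : Z => tt : Z). Proof. by []. Qed.
Fact zgm_addC : commutative (fun _ _ : Z => tt : Z). Proof. by []. Qed.
Fact zgm_add0 : left_id (tt : Z) (fun _ _ : Z => tt : Z). Proof. by case. Qed.
Fact zgm_addN : left_inverse (tt : Z) (fun _ : Z => tt : Z) (fun _ _ : Z => tt : Z).
Proof. by []. Qed.
HB.instance Definition _ :=
  GRing.isZmodule.Build Z zgm_addA zgm_addC zgm_add0 zgm_addN.

Fact zgm_act1 (x : Z) : (fun (_ : G) (y : Z) => y) 1%g x = x.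
Proof. by []. Qed.
HB.instance Definition _ := Zmodule_isGModule.Build G Z zgm_act1
  (fun _ _ _ => erefl) (fun _ _ _ => erefl).

End ZeroModule.

Section Cokernel.
Variables (G : groupType) (B D : gmodType G) (d : {gmodhom B -> D}).

Definition gim (x : D) : bool := `[< exists b, d b = x >].

Lemma gimP x : reflect (exists b, d b = x) (x \in gim).
Proof. exact: asboolP. Qed.

Fact gim_zmod_closed : zmod_closed gim.
Proof.
split=> [|x y /gimP[b <-] /gimP[c <-]]; apply/gimP.
  by exists 0; rewrite raddf0.
by exists (b - c); rewrite raddfB.
Qed.
HB.instance Definition _ := GRing.isZmodClosed.Build D gim gim_zmod_closed.

Definition gim_closed : zmodClosed D := GRing.ZmodClosed.clone D gim _.
Definition coker : Type := Quotient.quot gim_closed.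
HB.instance Definition _ := GRing.Zmodule.on coker.

Definition coker_proj (x : D) : coker := \pi_(Quotient.quot gim_closed) x.

Fact coker_proj_zmod_morphism : zmod_morphism coker_proj.
Proof. exact: raddfB. Qed.
HB.instance Definition _ := GRing.isZmodMorphism.Build D coker coker_proj
  coker_proj_zmod_morphism.

Lemma coker_projP x y :
  coker_proj x = coker_proj y <-> exists b, x = d b + y.
Proof.
have E : reflect (coker_proj x = coker_proj y) (x - y \in gim).
  by rewrite (Quotient.idealrBE gim_closed); exact: eqP.
split=> [/E/gimP[b db]|[b xE]]; first by exists b; rewrite db subrK.
by apply/E/gimP; exists b; rewrite xE addrK.
Qed.

Lemma coker_proj_surj c : exists x, coker_proj x = c.
Proof. by exists (repr (c : Quotient.quot gim_closed)); exact: reprK. Qed.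

Definition coker_act (s : G) (c : coker) : coker :=
  coker_proj (s ** repr (c : Quotient.quot gim_closed)).

Lemma coker_actE s x : coker_act s (coker_proj x) = coker_proj (s ** x).
Proof.
apply/coker_projP.
have [b ->] : exists b, repr (coker_proj x : Quotient.quot gim_closed) = d b + x.
  by apply/coker_projP; exact: reprK.
by exists (s ** b); rewrite gactD gactE.
Qed.

Fact coker_act1 c : coker_act 1%g c = c.
Proof. by have [x <-] := coker_proj_surj c; rewrite coker_actE gact1. Qed.
Fact coker_actM s t c : coker_act (s * t)%g c = coker_act s (coker_act t c).
Proof. by have [x <-] := coker_proj_surj c; rewrite !coker_actE gactM. Qed.
Fact coker_actD s (c c' : coker) :
  coker_act s (c + c') = coker_act s c + coker_act s c'.
Proof.
have [x <-] := coker_proj_surj c; have [y <-] := coker_proj_surj c'.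
by rewrite -raddfD !coker_actE gactD raddfD.
Qed.
HB.instance Definition _ := Zmodule_isGModule.Build G coker
  coker_act1 coker_actM coker_actD.

Fact coker_proj_equivariant (s : G) x :
  coker_proj (s ** x) = s ** coker_proj x.
Proof. by rewrite -[RHS]/(coker_act s _) coker_actE. Qed.
HB.instance Definition _ := isEquivariant.Build G D coker coker_proj
  coker_proj_equivariant.

End Cokernel.

(** D acts trivially on B and the braiding map is zero, so that the
    homomorphism d is the only remaining datum. *)
Record ab_xmod (G : groupType) := AbXMod {
  xB : gmodType G;
  xD : gmodType G;
  xd : {gmodhom xB -> xD}
}.

Section Extensions.
Variables (G : groupType) (M : ab_xmod G) (Q : gmodType G).

Record extension := Extension {
  ext_E : gmodType G;
  ext_j : {gmodhom xB M -> ext_E};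
  ext_p : {gmodhom ext_E -> Q};
  ext_eps : {gmodhom ext_E -> xD M};
  ext_j_inj : injective ext_j;
  ext_exact : forall e, ext_p e = 0 <-> exists b, ext_j b = e;
  ext_p_surj : forall u, exists e, ext_p e = u;
  ext_eps_j : forall b, ext_eps (ext_j b) = xd M b
}.

Definition ext_equiv (X Y : extension) : Prop :=
  exists a : {gmodhom ext_E X -> ext_E Y},
    [/\ forall b, a (ext_j X b) = ext_j Y b,
        forall e, ext_p Y (a e) = ext_p X e
      & forall e, ext_eps Y (a e) = ext_eps X e].

Definition ext_induces (X : extension) (psi : {gmodhom Q -> coker (xd M)}) :=
  forall e, psi (ext_p X e) = coker_proj (xd M) (ext_eps X e).

Lemma ext_equiv_refl X : ext_equiv X X.
Proof. by exists idfun; split. Qed.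

Lemma ext_equiv_trans X Y Z : ext_equiv X Y -> ext_equiv Y Z -> ext_equiv X Z.
Proof.
move=> [a [aj ap ae]] [b [bj bp be]]; exists (b \o a).
by split=> x /=; rewrite ?aj ?bp ?be.
Qed.

Lemma ext_equiv_sym X Y : ext_equiv X Y -> ext_equiv Y X.
Proof.
move=> [a [aj ap ae]].
have a_inj : injective a.
  move=> x y axy; apply/eqP; rewrite -subr_eq0; apply/eqP.
  have a0 : a (x - y) = 0 by rewrite raddfB /= axy subrr.
  have [b jb] : exists b, ext_j X b = x - y.
    by apply/ext_exact; rewrite -ap a0 raddf0.
  have b0 : b = 0 by apply: (@ext_j_inj Y); rewrite -aj jb a0 raddf0.
  by rewrite -jb b0 raddf0.
have a_surj y : exists x, a x = y.
  have [x px] := @ext_p_surj X (ext_p Y y).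
  have [b jb] : exists b, ext_j Y b = y - a x.
    by apply/ext_exact; rewrite raddfB /= ap px subrr.
  by exists (ext_j X b + x); rewrite raddfD /= aj jb subrK.
pose a' y := sval (cid (a_surj y)).
have a'K : cancel a' a by move=> y; exact: (svalP (cid (a_surj y))).
have a'B : zmod_morphism a'.
  by move=> x y; apply: a_inj; rewrite raddfB /= !a'K.
have a'G s y : a' (s ** y) = s ** a' y.
  by apply: a_inj; rewrite gactE !a'K.
pose h1 := GRing.isZmodMorphism.Build _ _ a' a'B.
pose h2 := isEquivariant.Build G _ _ a' a'G.
pose h : {gmodhom _ -> _} := HB.pack a' h1 h2.
exists h; split=> x /=.
- by apply: a_inj; rewrite /= a'K aj.
- by rewrite -ap a'K.
- by rewrite -ae a'K.
Qed.

Definition ext_over (psi : {gmodhom Q -> coker (xd M)}) : Type :=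
  {X : extension | ext_induces X psi}.

Definition ext_over_equiv psi (X Y : ext_over psi) : Prop :=
  ext_equiv (sval X) (sval Y).

Fact ext_over_equivP psi : is_equivalence (@ext_over_equiv psi).
Proof.
split=> [X|X Y|X Y Z]; first exact: ext_equiv_refl.
  exact: ext_equiv_sym.
exact: ext_equiv_trans.
Qed.

Definition Ext_classes (psi : {gmodhom Q -> coker (xd M)}) : Type :=
  classes (@ext_over_equiv psi).

End Extensions.

(** [f ;; g] is the composite "f followed by g"; [ggr] is the functor to the
    one-object category Gamma, with composition of arrows the product. *)
Record gcat (G : groupType) := GCat {
  gobj :> Type;
  ghom : gobj -> gobj -> Type;
  gid : forall x, ghom x x;
  gcomp : forall x y z, ghom x y -> ghom y z -> ghom x z;
  ggr : forall x y, ghom x y -> G;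
  gcompA : forall x y z t (f : ghom x y) (g : ghom y z) (h : ghom z t),
    gcomp f (gcomp g h) = gcomp (gcomp f g) h;
  gcomp1l : forall x y (f : ghom x y), gcomp (gid x) f = f;
  gcomp1r : forall x y (f : ghom x y), gcomp f (gid y) = f;
  ggr_id : forall x, ggr (gid x) = 1%g;
  ggr_comp : forall x y z (f : ghom x y) (g : ghom y z),
    ggr (gcomp f g) = (ggr g * ggr f)%g
}.

Arguments gid {G C} x : rename.
Arguments ggr {G C x y} f : rename.
Arguments gcomp {G C x y z} f g : rename.
Notation "f ;; g" := (gcomp f g) : gcat_scope.

Local Open Scope gcat_scope.

Definition ginvertible G (C : gcat G) (x y : C) (f : ghom x y) :=
  exists g : ghom y x, f ;; g = gid x /\ g ;; f = gid y.

Record gfunctor G (C C' : gcat G) := GFunctor {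
  gfobj :> C -> C';
  gfmap : forall x y, ghom x y -> ghom (gfobj x) (gfobj y);
  gfmap_id : forall x, gfmap (gid x) = gid (gfobj x);
  gfmap_comp : forall x y z (f : ghom x y) (g : ghom y z),
    gfmap (f ;; g) = gfmap f ;; gfmap g;
  gfmap_gr : forall x y (f : ghom x y), ggr (gfmap f) = ggr f
}.
Arguments gfmap {G C C'} F {x y} f : rename.

Section GCatConstructions.
Variable G : groupType.

Program Definition gone : gcat G :=
  @GCat G unit (fun _ _ => G) (fun _ => 1%g) (fun _ _ _ f g => (g * f)%g)
    (fun _ _ f => f) _ _ _ _ _.
Next Obligation. by move=> * /=; rewrite mulgA. Qed.
Next Obligation. by move=> * /=; rewrite mulg1. Qed.
Next Obligation. by move=> * /=; rewrite mul1g. Qed.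
Next Obligation. by []. Qed.
Next Obligation. by []. Qed.

Variables C1 C2 : gcat G.

Definition gpull_hom (x y : C1 * C2) : Type :=
  {f : ghom x.1 y.1 * ghom x.2 y.2 | ggr f.1 == ggr f.2}.

Fact gpull_id_subproof (x : C1 * C2) : ggr (gid x.1) == ggr (gid x.2).
Proof. by rewrite !ggr_id. Qed.
Definition gpull_id x : gpull_hom x x :=
  exist _ (gid x.1, gid x.2) (gpull_id_subproof x).

Fact gpull_comp_subproof x y z (f : gpull_hom x y) (g : gpull_hom y z) :
  ggr ((sval f).1 ;; (sval g).1) == ggr ((sval f).2 ;; (sval g).2).
Proof.
by rewrite !ggr_comp (eqP (svalP f)) (eqP (svalP g)).
Qed.
Definition gpull_comp x y z (f : gpull_hom x y) (g : gpull_hom y z) :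
    gpull_hom x z :=
  exist _ ((sval f).1 ;; (sval g).1, (sval f).2 ;; (sval g).2)
    (gpull_comp_subproof f g).

Program Definition gpull : gcat G :=
  @GCat G (C1 * C2)%type gpull_hom gpull_id gpull_comp
    (fun _ _ f => ggr (sval f).1) _ _ _ _ _.
Next Obligation. by move=> *; apply: val_inj; rewrite /= !gcompA. Qed.
Next Obligation. by move=> x y f; apply: val_inj; rewrite /= !gcomp1l; case: (sval f). Qed.
Next Obligation. by move=> x y f; apply: val_inj; rewrite /= !gcomp1r; case: (sval f). Qed.
Next Obligation. by move=> * /=; rewrite ggr_id. Qed.
Next Obligation. by move=> * /=; rewrite ggr_comp. Qed.

Definition gpair (x y : C1) (x' y' : C2) (f : ghom x y) (f' : ghom x' y')
    (e : ggr f = ggr f') : @ghom G gpull (x, x') (y, y') :=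
  exist _ (f, f') (introT eqP e).

End GCatConstructions.

Record gtcat (G : groupType) := GTCat {
  gt_cat :> gcat G;
  gtens : gfunctor (gpull gt_cat gt_cat) gt_cat;
  gunit : gfunctor (gone G) gt_cat
}.

Section TensorNotations.
Variables (G : groupType) (C : gtcat G).

Definition gto (x y : C) : C := gtens C (x, y).
Definition gtm (x y x' y' : C) (f : ghom x y) (f' : ghom x' y')
  (e : ggr f = ggr f') : ghom (gto x x') (gto y y') := gfmap (gtens C) (gpair e).
Definition gI : C := gunit C tt.
Definition gIm (s : G) : ghom gI gI :=
  @gfmap _ _ _ (gunit C) tt tt s.

End TensorNotations.

Arguments gto {G C} x y.
Arguments gtm {G C x y x' y'} f f' e.
Arguments gI {G C}.
Arguments gIm {G C} s.
Notation "x :*: y" := (gto x y) : gcat_scope.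

(** In the axioms below, [e] (and [e']) range over the proofs that the two
    morphisms being tensored have the same grade; [G] has decidable equality,
    so there is exactly one such proof.  Every morphism is invertible, so the
    constraints, the arrows from [x] required by stability and the components
    of natural transformations are automatically isomorphisms. *)
Record gpicard (G : groupType) := GPicard {
  gp_cat :> gtcat G;
  gp_assoc : forall x y z : gp_cat, ghom ((x :*: y) :*: z) (x :*: (y :*: z));
  gp_lu : forall x : gp_cat, ghom (gI :*: x) x;
  gp_ru : forall x : gp_cat, ghom (x :*: gI) x;
  gp_sym : forall x y : gp_cat, ghom (x :*: y) (y :*: x);
  gp_groupoid : forall (x y : gp_cat) (f : ghom x y), ginvertible f;
  gp_stable : forall (x : gp_cat) (s : G),
    exists (y : gp_cat) (f : ghom x y), ggr f = s;
  gp_assoc_gr : forall x y z, ggr (gp_assoc x y z) = 1%g;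
  gp_lu_gr : forall x, ggr (gp_lu x) = 1%g;
  gp_ru_gr : forall x, ggr (gp_ru x) = 1%g;
  gp_sym_gr : forall x y, ggr (gp_sym x y) = 1%g;
  gp_assoc_nat : forall (x y z x' y' z' : gp_cat)
      (f : ghom x x') (g : ghom y y') (h : ghom z z') e1 e2 e3 e4,
    gtm (gtm f g e1) h e2 ;; gp_assoc x' y' z' =
    gp_assoc x y z ;; gtm f (gtm g h e3) e4;
  gp_lu_nat : forall (x y : gp_cat) (f : ghom x y) e,
    gtm (gIm (ggr f)) f e ;; gp_lu y = gp_lu x ;; f;
  gp_ru_nat : forall (x y : gp_cat) (f : ghom x y) e,
    gtm f (gIm (ggr f)) e ;; gp_ru y = gp_ru x ;; f;
  gp_sym_nat : forall (x y x' y' : gp_cat) (f : ghom x x') (g : ghom y y') e e',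
    gtm f g e ;; gp_sym x' y' = gp_sym x y ;; gtm g f e';
  gp_pentagon : forall (x y z t : gp_cat) e e',
    gp_assoc (x :*: y) z t ;; gp_assoc x y (z :*: t) =
    gtm (gp_assoc x y z) (gid t) e ;; gp_assoc x (y :*: z) t
      ;; gtm (gid x) (gp_assoc y z t) e';
  gp_triangle : forall (x y : gp_cat) e e',
    gp_assoc x gI y ;; gtm (gid x) (gp_lu y) e = gtm (gp_ru x) (gid y) e';
  gp_hexagon : forall (x y z : gp_cat) e e',
    gp_assoc x y z ;; gp_sym x (y :*: z) ;; gp_assoc y z x =
    gtm (gp_sym x y) (gid z) e ;; gp_assoc y x z
      ;; gtm (gid y) (gp_sym x z) e';
  gp_symK : forall x y : gp_cat, gp_sym x y ;; gp_sym y x = gid (x :*: y);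
  gp_inv : forall x : gp_cat,
    exists (x' : gp_cat) (f : ghom (x :*: x') gI), ggr f = 1%g
}.

Section SymmetricMonoidalFunctors.
Variables (G : groupType) (C C' : gpicard G).

Record gsmfunctor := GSMFunctor {
  gsm_fun :> gfunctor C C';
  gsm_tens : forall x y : C,
    ghom (gsm_fun x :*: gsm_fun y) (gsm_fun (x :*: y));
  gsm_unit : ghom (@gI G C') (gsm_fun gI);
  gsm_tens_gr : forall x y, ggr (gsm_tens x y) = 1%g;
  gsm_unit_gr : ggr gsm_unit = 1%g;
  gsm_tens_nat : forall (x y x' y' : C) (f : ghom x x') (g : ghom y y') e e',
    gtm (gfmap gsm_fun f) (gfmap gsm_fun g) e ;; gsm_tens x' y' =
    gsm_tens x y ;; gfmap gsm_fun (gtm f g e');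
  gsm_assoc : forall (x y z : C) e e',
    gtm (gsm_tens x y) (gid (gsm_fun z)) e ;; gsm_tens (x :*: y) z
      ;; gfmap gsm_fun (gp_assoc x y z) =
    gp_assoc (gsm_fun x) (gsm_fun y) (gsm_fun z)
      ;; gtm (gid (gsm_fun x)) (gsm_tens y z) e' ;; gsm_tens x (y :*: z);
  gsm_lu : forall (x : C) e,
    gtm gsm_unit (gid (gsm_fun x)) e ;; gsm_tens gI x
      ;; gfmap gsm_fun (gp_lu x) = gp_lu (gsm_fun x);
  gsm_ru : forall (x : C) e,
    gtm (gid (gsm_fun x)) gsm_unit e ;; gsm_tens x gI
      ;; gfmap gsm_fun (gp_ru x) = gp_ru (gsm_fun x);
  gsm_sym : forall x y : C,
    gsm_tens x y ;; gfmap gsm_fun (gp_sym x y) =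
    gp_sym (gsm_fun x) (gsm_fun y) ;; gsm_tens y x
}.

Record homotopy (F F' : gsmfunctor) := Homotopy {
  htp :> forall x : C, ghom (F x) (F' x);
  htp_gr : forall x, ggr (htp x) = 1%g;
  htp_nat : forall (x y : C) (f : ghom x y),
    gfmap F f ;; htp y = htp x ;; gfmap F' f;
  htp_tens : forall (x y : C) e,
    gtm (htp x) (htp y) e ;; gsm_tens F' x y = gsm_tens F x y ;; htp (x :*: y);
  htp_unit : gsm_unit F ;; htp gI = gsm_unit F'
}.

Definition homotopic (F F' : gsmfunctor) : Prop := inhabited (homotopy F F').

End SymmetricMonoidalFunctors.

Section HomotopyEquivalence.
Variable G : groupType.

Lemma gtm_irr (C : gtcat G) (x y x' y' : C) (f : ghom x y) (g : ghom x' y')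
  e e' : gtm f g e = gtm f g e'.
Proof. by rewrite (eq_irrelevance e e'). Qed.

Lemma gtm_eq (C : gtcat G) (x y x' y' : C) (f f1 : ghom x y)
    (g g1 : ghom x' y') e e' :
  f = f1 -> g = g1 -> gtm f g e = gtm f1 g1 e'.
Proof. by move=> ff gg; subst; exact: gtm_irr. Qed.

Lemma gtm_id (C : gtcat G) (x y : C) e : gtm (gid x) (gid y) e = gid (x :*: y).
Proof. by rewrite -[RHS]gfmap_id; congr gfmap; apply: val_inj. Qed.

Lemma gtm_comp (C : gtcat G) (x y z x' y' z' : C) (f : ghom x y) (g : ghom y z)
    (f' : ghom x' y') (g' : ghom y' z') e e1 e2 :
  gtm (f ;; g) (f' ;; g') e = gtm f f' e1 ;; gtm g g' e2.
Proof. by rewrite -[RHS]gfmap_comp; congr gfmap; apply: val_inj. Qed.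

Variables C C' : gpicard G.
Implicit Types F : gsmfunctor C C'.

Lemma homotopic_refl F : homotopic F F.
Proof.
constructor; exists (fun x => gid (F x)) => *; first exact: ggr_id.
- by rewrite gcomp1l gcomp1r.
- by rewrite gtm_id gcomp1l gcomp1r.
- by rewrite gcomp1r.
Qed.

Lemma homotopic_trans F1 F2 F3 :
  homotopic F1 F2 -> homotopic F2 F3 -> homotopic F1 F3.
Proof.
move=> [t] [u]; constructor; exists (fun x => t x ;; u x).
- by move=> x; rewrite ggr_comp !htp_gr mulg1.
- by move=> x y f; rewrite gcompA htp_nat -gcompA htp_nat gcompA.
- move=> x y e; have ge x' y' F F' (h : homotopy F F') : ggr (h x') = ggr (h y').
    by rewrite !htp_gr.
  by rewrite (gtm_comp _ (ge x y _ _ t) (ge x y _ _ u)) -gcompA htp_tens gcompA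
             htp_tens gcompA.
- by rewrite gcompA !htp_unit.
Qed.

Lemma homotopic_sym F1 F2 : homotopic F1 F2 -> homotopic F2 F1.
Proof.
move=> [t]; pose v x := cid (gp_groupoid (t x)).
pose u x := sval (v x).
have tu x : t x ;; u x = gid _ by case: (svalP (v x)).
have ut x : u x ;; t x = gid _ by case: (svalP (v x)).
have ugr x : ggr (u x) = 1%g.
  by have := ggr_comp (t x) (u x); rewrite tu ggr_id htp_gr mulg1 => <-.
constructor; exists u => //.
- move=> x y f; rewrite -[LHS]gcomp1l -(ut x) -gcompA [t x ;; _]gcompA -htp_nat.
  by rewrite -[gfmap F1 f ;; _ ;; _]gcompA tu gcomp1r.
- move=> x y e; have e' : ggr (t x) = ggr (t y) by rewrite !htp_gr.
  have tuE : gtm (u x) (u y) e ;; gtm (t x) (t y) e' = gid _.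
    have e3 : ggr (u x ;; t x) = ggr (u y ;; t y) by rewrite !ut !ggr_id.
    have e4 : ggr (gid (F2 x)) = ggr (gid (F2 y)) by rewrite !ggr_id.
    by rewrite -(gtm_comp e3) (gtm_eq _ e4 (ut x) (ut y)) gtm_id.
  rewrite -[LHS]gcomp1r -(tu (x :*: y)) gcompA -[_ ;; t _]gcompA -htp_tens.
  by rewrite [gtm (u _) _ _ ;; _]gcompA tuE gcomp1l.
- by rewrite -(htp_unit t) -gcompA tu gcomp1r.
Qed.

End HomotopyEquivalence.

Section XModPicard.
Variables (G : groupType) (M : ab_xmod G).
Local Notation B := (xB M).
Local Notation D := (xD M).
Local Notation d := (xd M).

Definition xm_hom (x y : D) : Type :=
  {m : B * G | m.2 ** x == d m.1 + y}.

Definition XMHom (x y : D) (b : B) (s : G) (h : s ** x = d b + y) : xm_hom x y :=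
  exist _ (b, s) (introT eqP h).

Lemma xm_homP (x y : D) (f : xm_hom x y) :
  (sval f).2 ** x = d (sval f).1 + y.
Proof. exact/eqP/(svalP f). Qed.

Fact xm_id_subproof (x : D) : 1%g ** x = d 0 + x.
Proof. by rewrite gact1 raddf0 add0r. Qed.

Fact xm_comp_subproof (x y z : D) (f : xm_hom x y) (g : xm_hom y z) :
  ((sval g).2 * (sval f).2)%g ** x =
  d ((sval g).2 ** (sval f).1 + (sval g).1) + z.
Proof. by rewrite gactM xm_homP gactD xm_homP -gactE raddfD addrA. Qed.

Program Definition xm_cat : gcat G :=
  @GCat G D xm_hom (fun x => XMHom (xm_id_subproof x))
    (fun x y z f g => XMHom (xm_comp_subproof f g))
    (fun x y f => (sval f).2) _ _ _ _ _.
Next Obligation.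
by move=> *; apply: val_inj; rewrite /= gactD gactM addrA mulgA.
Qed.
Next Obligation.
move=> x y f; apply: val_inj; rewrite /= gact0 add0r mulg1.
by case: (sval f).
Qed.
Next Obligation.
move=> x y f; apply: val_inj; rewrite /= gact1 addr0 mul1g.
by case: (sval f).
Qed.
Next Obligation. by []. Qed.
Next Obligation. by []. Qed.

Fact xm_tens_subproof (x y : gpull xm_cat xm_cat) (f : ghom x y) :
  (sval (sval f).1).2 ** (x.1 + x.2 : D) =
  d ((sval (sval f).1).1 + (sval (sval f).2).1) + (y.1 + y.2).
Proof.
have /eqP e := svalP f; rewrite gactD xm_homP.
by move: e => /= ->; rewrite xm_homP raddfD addrACA.
Qed.

Program Definition xm_tens : gfunctor (gpull xm_cat xm_cat) xm_cat :=
  @GFunctor G (gpull xm_cat xm_cat) xm_cat (fun x => x.1 + x.2 : D)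
    (fun x y f => XMHom (xm_tens_subproof f)) _ _ _.
Next Obligation. by move=> x; apply: val_inj; rewrite /= addr0. Qed.
Next Obligation.
move=> x y z f g; apply: val_inj; rewrite /= gactD.
have /eqP /= e := svalP g.
by congr (_, _); rewrite -e addrACA.
Qed.
Next Obligation. by []. Qed.

Fact xm_unit_subproof (s : G) : s ** (0 : D) = d 0 + 0.
Proof. by rewrite gact0 raddf0 addr0. Qed.

Program Definition xm_unit : gfunctor (gone G) xm_cat :=
  @GFunctor G (gone G) xm_cat (fun=> 0 : D)
    (fun _ _ s => XMHom (xm_unit_subproof s)) _ _ _.
Next Obligation. by move=> x; apply: val_inj. Qed.
Next Obligation. by move=> *; apply: val_inj; rewrite /= gact0 addr0. Qed.
Next Obligation. by []. Qed.

Definition xm_tcat : gtcat G := GTCat xm_tens xm_unit.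

(** The identity constraints: the sources and targets are equal elements of
    D, but not convertible ones. *)
Fact xm_idc_subproof (x y : D) : x = y -> 1%g ** x = d 0 + y.
Proof. by move=> ->; exact: xm_id_subproof. Qed.
Definition xm_idc (x y : D) (h : x = y) : xm_hom x y :=
  XMHom (xm_idc_subproof h).

Fact xm_assoc_subproof (x y z : D) : x + y + z = x + (y + z).
Proof. by rewrite addrA. Qed.

Fact xm_inv_subproof (x y : D) (b : B) (s : G) :
  s ** x = d b + y -> s^-1%g ** y = d (- (s^-1%g ** b)) + x.
Proof.
move=> h; rewrite -[x in RHS]gact1 -(mulVg s) gactM h gactD raddfN /= gactE.
by rewrite addKr.
Qed.

Fact xm_groupoid (x y : xm_cat) (f : ghom x y) : ginvertible f.
Proof.
have h := xm_inv_subproof (xm_homP f).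
exists (XMHom h); split; apply: val_inj => /=.
  by rewrite subrr mulVg.
by rewrite gactN -gactM mulgV gact1 addNr.
Qed.

Program Definition xm_picard : gpicard G :=
  @GPicard G xm_tcat
    (fun x y z => xm_idc (xm_assoc_subproof x y z))
    (fun x => xm_idc (add0r x))
    (fun x => xm_idc (addr0 x))
    (fun x y => xm_idc (addrC x y))
    xm_groupoid _ _ _ _ _ _ _ _ _ _ _ _ _ _.
Next Obligation.
move=> x s; have h : s ** x = d 0 + s ** x by rewrite raddf0 add0r.
by exists (s ** x), (XMHom h).
Qed.
Next Obligation. by []. Qed.
Next Obligation. by []. Qed.
Next Obligation. by []. Qed.
Next Obligation. by []. Qed.
Next Obligation.
move=> *; apply: val_inj; rewrite /= gact1 gact0 addr0 add0r mulg1 mul1g.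
by rewrite addrA.
Qed.
Next Obligation.
by move=> *; apply: val_inj; rewrite /= gact1 gact0 addr0 !add0r mulg1 mul1g.
Qed.
Next Obligation.
by move=> *; apply: val_inj; rewrite /= gact1 gact0 !addr0 !add0r mulg1 mul1g.
Qed.
Next Obligation.
move=> x y x' y' f g e e'; apply: val_inj.
rewrite /= gact1 gact0 !addr0 !add0r mulg1 mul1g.
by move: e => /= ->; rewrite addrC.
Qed.
Next Obligation. by move=> *; apply: val_inj; rewrite /= !gact1 !addr0 !mulg1. Qed.
Next Obligation. by move=> *; apply: val_inj; rewrite /= !gact1 !addr0 !mulg1. Qed.
Next Obligation. by move=> *; apply: val_inj; rewrite /= !gact1 !addr0 !mulg1. Qed.
Next Obligation. by move=> *; apply: val_inj; rewrite /= !gact1 !addr0 !mulg1. Qed.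
Next Obligation.
by move=> x; exists (- x : D), (xm_idc (subrr (x : D))).
Qed.

End XModPicard.

Definition gdis (G : groupType) (Q : gmodType G) : gpicard G :=
  xm_picard (@AbXMod G (zero_gmod G) Q (@gzero G (zero_gmod G) Q)).

Section HomClasses.
Variables (G : groupType) (M : ab_xmod G) (Q : gmodType G).
Variable psi : {gmodhom Q -> coker (xd M)}.

(** The component 0 of the pair (psi, 0) imposes no condition. *)
Definition fun_induces (F : gsmfunctor (gdis Q) (xm_picard M)) : Prop :=
  forall u : Q, coker_proj (xd M) (F u : xD M) = psi u.

Definition fun_over : Type :=
  {F : gsmfunctor (gdis Q) (xm_picard M) | fun_induces F}.

Definition fun_over_homotopic (F F' : fun_over) : Prop :=
  homotopic (sval F) (sval F').

Fact fun_over_homotopicP : is_equivalence fun_over_homotopic.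
Proof.
split=> [F|F F'|F F' F'']; first exact: homotopic_refl.
  exact: homotopic_sym.
exact: homotopic_trans.
Qed.

Definition Hom_classes : Type := classes fun_over_homotopic.

End HomClasses.

(* Main.v *)
(** Both sides are classified by the same cocycles.  A section [s] of the
    projection of an extension E fails to be Gamma-linear by elements of B:
      s u + s v = j (g u v) + s (u + v)  and  sigma (s u) = j (f u sigma) + s (sigma u).
    The equations satisfied by [f] and [g] are exactly those making
    [u |-> eps (s u)], [f] and [g] a graded symmetric monoidal functor, and a
    change of section is a homotopy.  So functors and extensions are compared
    through the relation "F is read off some section of E", which is total,
    surjective, and matches homotopy with equivalence. *)
From HB Require Import structures.
Require Import Defs.
From mathcomp Require Import all_boot all_algebra.
From mathcomp Require Import boolp.

Set Implicit Arguments.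
Unset Strict Implicit.
Unset Printing Implicit Defensive.

Import GRing.Theory.

Local Open Scope ring_scope.
Local Open Scope gcat_scope.
#[local] Obligation Tactic := idtac.

(** * Bijections between sets of classes from a relation between representatives *)

Lemma classes_bijection (T T' : Type) (R : T -> T -> Prop)
    (R' : T' -> T' -> Prop) (S : T -> T' -> Prop) :
  is_equivalence R -> is_equivalence R' ->
  (forall x, exists y, S x y) -> (forall y, exists x, S x y) ->
  (forall x x' y y', S x y -> S x' y' -> (R x x' <-> R' y y')) ->
  exists f : classes R -> classes R', bijective f.
Proof.
move=> [Rr Rs Rt] [Rr' Rs' Rt'] St Ss SR.
pose rep (X : Type) (r : X -> X -> Prop) (c : classes r) : X :=
  sval (cid (svalP c)).
have repE (X : Type) (r : X -> X -> Prop) (c : classes r) : sval c = r (rep X r c).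
  exact: svalP (cid (svalP c)).
pose cls (X : Type) (r : X -> X -> Prop) x : classes r :=
  exist _ (r x) (ex_intro _ x erefl).
have clsP (X : Type) (r : X -> X -> Prop) (c c' : classes r) : sval c = sval c' -> c = c'.
  by case: c c' => [P hP] [P' hP'] /= e; subst P'; congr exist; exact: Prop_irrelevance.
pose f (c : classes R) : classes R' := cls _ R' (sval (cid (St (rep _ _ c)))).
pose g (c : classes R') : classes R := cls _ R (sval (cid (Ss (rep _ _ c)))).
have eqR x y : R x y -> R x = R y.
  move=> xy; apply: funext => z; apply: propext; split; last exact: Rt.
  exact: Rt (Rs _ _ xy).
have eqR' x y : R' x y -> R' x = R' y.
  move=> xy; apply: funext => z; apply: propext; split; last exact: Rt'.
  exact: Rt' (Rs' _ _ xy).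
exists f; exists g => c.
(* [SR] moves the goal to the [R'] side: there it relates the representative picked in [f c] to the
   element whose class [f c] is, and [repE] reduces this to reflexivity. *)
- apply: clsP; rewrite [sval c]repE; apply: eqR; apply/(SR _ _ _ _ (svalP (cid (Ss _))) (svalP (cid (St _)))).
  by rewrite -repE; exact: Rr'.
- apply: clsP; rewrite [sval c]repE; apply: eqR'; apply/(SR _ _ _ _ (svalP (cid (St _))) (svalP (cid (Ss _)))).
  by rewrite -repE; exact: Rr.
Qed.

(** * Identities in abelian groups *)

Lemma zmod_of_add (U V : zmodType) (f : U -> V) :
  {morph f : x y / x + y} -> zmod_morphism f.
Proof.
by move=> fD x y; apply: (addIr (f y)); rewrite -fD !subrK.
Qed.

(** Associativity for a functor read off a section: [a], [b], [c] are values of the section, [x],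
    [y] its values on partial sums, [z], [t] those on the two bracketings of the triple sum. The
    term [z - t] comes from the associativity arrow, whose ends are equal but not convertible. *)
Lemma sec_assoc_identity (V : zmodType) (a b c x y z t : V) :
  a + b - x + (x + c - z) + (z - t) = 0 + (b + c - y) + (a + y - t).
Proof.
rewrite -[x + c - z]addrA subrKA [a + b + _]addrA subrKA add0r.
rewrite [a + y]addrC -[y + a - t]addrA subrKA [RHS]addrA.
by congr (_ - _); rewrite [RHS]addrC addrA.
Qed.

(** How a defect [a] of a section becomes [f] when the section is corrected: [w] and [z] are the
    corrections on the two sides of the section equation. *)
Lemma coboundary_shift (V : zmodType) (a f w x z : V) :
  w + f = a + z -> a + x - w = f + (x - z).
Proof.
move=> wf; apply: (addIr (w + z)).
rewrite addrA subrK addrAC -wf.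
by rewrite [RHS]addrACA subrK [f + w]addrC.
Qed.

Section Cocycle.
Variables (G : groupType) (M : ab_xmod G) (Q : gmodType G).
Local Notation B := (xB M).
Local Notation D := (xD M).
Local Notation d := (xd M).
Local Notation smfun := (gsmfunctor (gdis Q) (xm_picard M)).

Fact dis_arrow_subproof (u : Q) (s : G) :
  s ** u = @gzero G (zero_gmod G) Q tt + s ** u.
Proof. by rewrite add0r. Qed.

(** Source and grade determine an arrow of [gdis Q], so a functor on arrows amounts to its values on
    these. *)
Definition dis_arrow (u : Q) (s : G) :
    @ghom G (gdis Q) u (s ** u) :=
  @XMHom G (@AbXMod G (zero_gmod G) Q (@gzero G (zero_gmod G) Q))
    u (s ** u) tt s (dis_arrow_subproof u s).

(** * The cocycle of a functor and its identities *)

Section FunctorCocycle.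
Variable F : smfun.

Definition fobj (u : Q) : D := F u.
Definition fact (u : Q) (s : G) : B := (sval (gfmap F (dis_arrow u s))).1.
Definition fadd (u v : Q) : B := (sval (gsm_tens F u v)).1.
Definition funit : B := (sval (gsm_unit F)).1.

(** The target of [m] must equal [s ** u]; once it is substituted, [m] is [dis_arrow u s] up to a
    proof, and [F] preserves its grade. *)
Lemma gfmapE (u v : Q) (m : @ghom G (gdis Q) u v) :
  sval (gfmap F m) = (fact u (sval m).2, (sval m).2).
Proof.
case: m => [[[] s] h] /=.
have e : v = s ** u by rewrite (eqP h) /= add0r.
move: h; rewrite {}e => h.
have -> : exist _ (tt, s) h = dis_arrow u s by apply: val_inj.
have /= := gfmap_gr F (dis_arrow u s).
by rewrite /fact; case: (sval _) => b t /= ->.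
Qed.

Lemma gsm_tensE (u v : Q) : sval (gsm_tens F u v) = (fadd u v, 1%g).
Proof. by have /= <- := gsm_tens_gr F u v; rewrite /fadd; case: (sval _). Qed.

Lemma gsm_unitE : sval (gsm_unit F) = (funit, 1%g).
Proof. by have /= <- := gsm_unit_gr F; rewrite /funit; case: (sval _). Qed.

Lemma fact_d u s : s ** fobj u = d (fact u s) + fobj (s ** u).
Proof. by have := xm_homP (gfmap F (dis_arrow u s)); rewrite gfmapE. Qed.

Lemma fadd_d u v : fobj u + fobj v = d (fadd u v) + fobj (u + v).
Proof. by have := xm_homP (gsm_tens F u v); rewrite gsm_tensE /= gact1. Qed.

Lemma funit_d : 0 = d funit + fobj 0.
Proof. by have := xm_homP (gsm_unit F); rewrite gsm_unitE /= gact1. Qed.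

Lemma fact1 u : fact u 1%g = 0.
Proof. by have /(congr1 sval) := @gfmap_id _ _ _ F u; rewrite gfmapE => -[]. Qed.

Lemma factM u s t : fact u (t * s)%g = t ** fact u s + fact (s ** u) t.
Proof.
have /(congr1 sval) := gfmap_comp F (dis_arrow u s) (dis_arrow (s ** u) t).
by rewrite gfmapE /= !gfmapE => -[].
Qed.

Lemma faddG u v s :
  fact u s + fact v s + fadd (s ** u) (s ** v) = s ** fadd u v + fact (u + v) s.
Proof.
have e : ggr (gfmap F (dis_arrow u s)) = ggr (gfmap F (dis_arrow v s)).
  by rewrite !gfmap_gr.
have e' : ggr (dis_arrow u s) = ggr (dis_arrow v s) by [].
have /(congr1 sval) := @gsm_tens_nat _ _ _ F _ _ _ _ _ _ e e'.
by rewrite /= !gfmapE !gsm_tensE /= gact1 => -[].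
Qed.

Lemma faddA u v w : fadd u v + fadd (u + v) w = fadd v w + fadd u (v + w).
Proof.
have e : ggr (gsm_tens F u v) = ggr (gid (F w)) by rewrite gsm_tens_gr ggr_id.
have e' : ggr (gid (F u)) = ggr (gsm_tens F v w) by rewrite gsm_tens_gr ggr_id.
have /(congr1 sval) := gsm_assoc e e'.
rewrite /= !gfmapE !gsm_tensE /= !gact1 fact1 => -[].
by rewrite !addr0 !add0r.
Qed.

Lemma faddC u v : fadd u v = fadd v u.
Proof.
have /(congr1 sval) := gsm_sym F u v.
rewrite /= !gfmapE !gsm_tensE /= !gact1 fact1 => -[].
by rewrite addr0 add0r.
Qed.

Lemma fadd0 u : funit + fadd 0 u = 0.
Proof.
have e : ggr (gsm_unit F) = ggr (gid (F u)) by rewrite gsm_unit_gr ggr_id.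
have /(congr1 sval) := gsm_lu e.
rewrite /= !gfmapE !gsm_tensE /= !gsm_unitE /= !gact1 fact1 => -[].
by rewrite !addr0.
Qed.

(** This is [faddG] at [u = v = 0], since [fadd 0 0 = - funit]. *)
Lemma fact0 s : s ** funit + fact 0 s = funit.
Proof.
have := faddG 0 0 s; rewrite !gact0 addr0.
have -> : fadd 0 0 = - funit.
  by apply/eqP; rewrite -addr_eq0 addrC fadd0.
rewrite gactN [RHS]addrC -addrA => /addrI h.
by rewrite -[s ** _]opprK -h opprB subrK.
Qed.

End FunctorCocycle.

(** * The relation between functors and extensions *)

Lemma ext_pj (X : extension M Q) b : ext_p X (ext_j X b) = 0.
Proof. by apply/ext_exact; exists b. Qed.

(** No equation for [funit] appears because [fadd0] forces [funit = - fadd 0 0]. *)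
Definition reads (F : smfun) (X : extension M Q) : Prop :=
  exists s : Q -> ext_E X,
    [/\ forall u, ext_p X (s u) = u,
        forall u, ext_eps X (s u) = fobj F u,
        forall u v, s u + s v = ext_j X (fadd F u v) + s (u + v)
      & forall u t, t ** s u = ext_j X (fact F u t) + s (t ** u)].

(** Any [e] differs from [s (p e)] by some [j b], and [eps (j b) = d b] dies in the cokernel. *)
Lemma reads_induces F X psi :
  reads F X -> (fun_induces psi F <-> ext_induces X psi).
Proof.
move=> [s [ps es _ _]]; split=> [h e|h u]; last first.
  by rewrite -[RHS]/(psi u) -[in RHS](ps u) h es.
have [b jb] : exists b, ext_j X b = e - s (ext_p X e).
  by apply/ext_exact; rewrite raddfB /= ps subrr.
rewrite -h; apply/esym/coker_projP; exists b.
by rewrite -(ext_eps_j X) jb raddfB /= es subrK.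
Qed.

(** * From a functor to an extension *)

Section TwistedSum.
Variable F : smfun.

(** The pair [(b, u)] stands for [j b + s u]. The section is not normalised: [s 0 = - j funit],
    whence the zero [(funit, 0)] and the shift by [funit] in [tw_j]. *)
Definition twisted : Type := (B * Q)%type.
HB.instance Definition _ := Choice.on twisted.

Definition tw_add (x y : twisted) : twisted :=
  (x.1 + y.1 + fadd F x.2 y.2, x.2 + y.2).
Definition tw_opp (x : twisted) : twisted :=
  (funit F - x.1 - fadd F (- x.2) x.2, - x.2).
Definition tw_zero : twisted := (funit F, 0).
Definition tw_act (t : G) (x : twisted) : twisted :=
  (t ** x.1 + fact F x.2 t, t ** x.2).

(** The module axioms mirror the cocycle identities: associativity is [faddA], commutativity
    [faddC], the neutral element [fadd0], and the action axioms are [fact1], [factM] and [faddG]. *)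
Fact tw_addA : associative tw_add.
Proof.
move=> [a u] [b v] [c w]; congr (_, _); rewrite /= addrA //.
by rewrite [a + b + _ + c]addrAC -[RHS]addrA faddA [RHS]addrA !addrA.
Qed.

Fact tw_addC : commutative tw_add.
Proof.
by move=> [a u] [b v]; rewrite /tw_add /= faddC [a + b]addrC [u + v]addrC.
Qed.

Fact tw_add0 : left_id tw_zero tw_add.
Proof.
by move=> [a u]; rewrite /tw_add /= addrAC fadd0 !add0r.
Qed.

Fact tw_addN : left_inverse tw_zero tw_opp tw_add.
Proof.
move=> [a u]; rewrite /tw_add /= addNr; congr (_, _).
by rewrite addrAC subrK subrK.
Qed.

HB.instance Definition _ :=
  GRing.isZmodule.Build twisted tw_addA tw_addC tw_add0 tw_addN.

Fact tw_act1 x : tw_act 1%g x = x.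
Proof. by case: x => b u; rewrite /tw_act /= !gact1 fact1 addr0. Qed.

Fact tw_actM t r x : tw_act (t * r)%g x = tw_act t (tw_act r x).
Proof. by case: x => b u; rewrite /tw_act /= !gactM factM gactD addrA. Qed.

Fact tw_actD t (x y : twisted) : tw_act t (x + y) = tw_act t x + tw_act t y.
Proof.
case: x y => [b u] [c v]; rewrite /tw_act /= !gactD; congr (_, _).
by rewrite -addrA -faddG [in RHS]addrACA !addrA.
Qed.

HB.instance Definition _ :=
  Zmodule_isGModule.Build G twisted tw_act1 tw_actM tw_actD.

Definition tw_j (b : B) : twisted := (b + funit F, 0).
Definition tw_p (x : twisted) : Q := x.2.
Definition tw_eps (x : twisted) : D := d x.1 + fobj F x.2.

Fact tw_jD : {morph tw_j : b c / b + c}.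
Proof.
move=> b c; congr (_, _); last by rewrite /= addr0.
by rewrite /= addrACA -[RHS]addrA -[funit F + _ + _]addrA fadd0 addr0.
Qed.
HB.instance Definition _ :=
  GRing.isZmodMorphism.Build B twisted tw_j (zmod_of_add tw_jD).

Fact tw_j_equivariant t b : tw_j (t ** b) = t ** tw_j b.
Proof.
congr (_, _); last by rewrite /= gact0.
by rewrite /= gactD -addrA fact0.
Qed.
HB.instance Definition _ :=
  isEquivariant.Build G B twisted tw_j tw_j_equivariant.

Fact tw_pB : zmod_morphism tw_p. Proof. by []. Qed.
HB.instance Definition _ := GRing.isZmodMorphism.Build twisted Q tw_p tw_pB.
Fact tw_p_equivariant t x : tw_p (t ** x) = t ** tw_p x. Proof. by []. Qed.
HB.instance Definition _ :=
  isEquivariant.Build G twisted Q tw_p tw_p_equivariant.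

(** The endpoint equations [fadd_d], [fact_d] and [funit_d] give, in turn, additivity and
    equivariance of [tw_eps] and the identity [tw_eps_j]. *)
Fact tw_epsD : {morph tw_eps : x y / x + y}.
Proof.
move=> x y; rewrite /tw_eps /= !raddfD /= -addrA -fadd_d.
by rewrite addrACA.
Qed.
HB.instance Definition _ :=
  GRing.isZmodMorphism.Build twisted D tw_eps (zmod_of_add tw_epsD).

Fact tw_eps_equivariant t x : tw_eps (t ** x) = t ** tw_eps x.
Proof. by rewrite /tw_eps /= raddfD /= gactD fact_d gactE addrA. Qed.
HB.instance Definition _ :=
  isEquivariant.Build G twisted D tw_eps tw_eps_equivariant.

Fact tw_j_inj : injective tw_j.
Proof. by move=> b c [] /addIr. Qed.

Fact tw_exact x : tw_p x = 0 <-> exists b, tw_j b = x.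
Proof.
split=> [|[b <-] //]; case: x => b u /= u0; exists (b - funit F).
by rewrite /tw_j subrK -u0.
Qed.

Fact tw_p_surj u : exists x, tw_p x = u.
Proof. by exists (0, u). Qed.

Fact tw_eps_j b : tw_eps (tw_j b) = d b.
Proof. by rewrite /tw_eps /= raddfD /= -addrA -funit_d addr0. Qed.

Definition tw_ext : extension M Q :=
  @Extension G M Q twisted tw_j tw_p tw_eps
    tw_j_inj tw_exact tw_p_surj tw_eps_j.

Lemma reads_twisted : reads F tw_ext.
Proof.
(* The shift by [funit] in [tw_j] cancels [fadd 0 u], so the section [u |-> (0, u)] has defects
   exactly [fadd] and [fact]. *)
have jE b u : tw_j b + ((0, u) : twisted) = (b, u).
  congr (_, _); last exact: add0r.
  by rewrite /= addr0 -addrA fadd0 addr0.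
exists (fun u => (0, u)); split=> //= [u|u v|u t].
- by rewrite /tw_eps raddf0 add0r.
- by rewrite jE; congr (_, _); rewrite /= !add0r.
- by rewrite jE; congr (_, _); rewrite /= gact0 add0r.
Qed.

End TwistedSum.

(** * From an extension with a chosen section to a functor *)

Section SectionFunctor.
Variables (X : extension M Q) (s : Q -> ext_E X).
Hypothesis ps : forall u, ext_p X (s u) = u.
Local Notation j := (ext_j X).
Local Notation p := (ext_p X).
Local Notation eps := (ext_eps X).

Fact kerE e : p e = 0 -> exists b, j b = e.
Proof. by move/ext_exact. Qed.

Fact sec_act_subproof (u v : Q) (m : @ghom G (gdis Q) u v) :
  exists b, j b = (sval m).2 ** s u - s v.
Proof.
apply: kerE; rewrite raddfB /= gactE !ps.
by rewrite (xm_homP m) add0r subrr.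
Qed.
(** Indexing by arrows, with [s v] as the subtracted term, avoids transport along the equation that
    identifies the target [v]. *)
Definition sec_act (u v : Q) (m : @ghom G (gdis Q) u v) : B :=
  sval (cid (sec_act_subproof m)).
Lemma sec_actP (u v : Q) (m : @ghom G (gdis Q) u v) :
  j (sec_act m) = (sval m).2 ** s u - s v.
Proof. exact: svalP (cid (sec_act_subproof m)). Qed.

Fact sec_add_subproof (u v : Q) : exists b, j b = s u + s v - s (u + v).
Proof. by apply: kerE; rewrite raddfB raddfD /= !ps subrr. Qed.
Definition sec_add (u v : Q) : B := sval (cid (sec_add_subproof u v)).
Lemma sec_addP (u v : Q) : j (sec_add u v) = s u + s v - s (u + v).
Proof. exact: svalP (cid (sec_add_subproof u v)). Qed.

Fact sec_unit_subproof : exists b, j b = - s 0.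
Proof. by apply: kerE; rewrite raddfN /= ps oppr0. Qed.
Definition sec_unit : B := sval (cid sec_unit_subproof).
Lemma sec_unitP : j sec_unit = - s 0.
Proof. exact: svalP (cid sec_unit_subproof). Qed.

Definition sec_obj (u : gdis Q) : xm_picard M := eps (s u).

Fact sec_map_subproof (u v : Q) (m : @ghom G (gdis Q) u v) :
  (sval m).2 ** eps (s u) = d (sec_act m) + eps (s v).
Proof. by rewrite -(ext_eps_j X) sec_actP raddfB /= gactE subrK. Qed.
Definition sec_map (u v : gdis Q) (m : ghom u v) :
    ghom (sec_obj u) (sec_obj v) := XMHom (sec_map_subproof m).

(** As [j] is injective, the equations in [B] are tested after applying [j], where they become
    telescoping identities between values of [s]. The same holds for [sec_smfun]. *)
Program Definition sec_functor : gfunctor (gdis Q) (xm_picard M) :=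
  @GFunctor G (gdis Q) (xm_picard M) sec_obj sec_map _ _ _.
Next Obligation.
move=> u; apply: val_inj; congr (_, _); apply: (@ext_j_inj _ _ _ X).
by rewrite sec_actP /= gact1 subrr raddf0.
Qed.
Next Obligation.
move=> u v w m n; apply: val_inj; congr (_, _); apply: (@ext_j_inj _ _ _ X).
by rewrite raddfD /= gactE !sec_actP /= gactD gactN -gactM addrA subrK.
Qed.
Next Obligation. by []. Qed.

Fact sec_tens_subproof (u v : Q) :
  1%g ** (eps (s u) + eps (s v)) = d (sec_add u v) + eps (s (u + v)).
Proof. by rewrite gact1 -(ext_eps_j X) sec_addP raddfB raddfD /= subrK. Qed.

Fact sec_unit_hom_subproof : 1%g ** (0 : D) = d sec_unit + eps (s 0).
Proof. by rewrite gact1 -(ext_eps_j X) sec_unitP raddfN /= addNr. Qed.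

Program Definition sec_smfun : smfun :=
  @GSMFunctor G (gdis Q) (xm_picard M) sec_functor
    (fun u v => XMHom (sec_tens_subproof u v)) (XMHom sec_unit_hom_subproof)
    _ _ _ _ _ _ _.
Next Obligation. by []. Qed.
Next Obligation. by []. Qed.
Next Obligation.
move=> u v u' v' m n e e'; apply: val_inj.
congr (_, _); last by rewrite /= mulg1 mul1g.
apply: (@ext_j_inj _ _ _ X); rewrite /= gact1 !raddfD /= gactE !sec_addP !sec_actP.
(* Both arrows have the same grade, so one group element acts on [s u] and [s v]. *)
move: e' => /= e'; rewrite -e' [_ + (_ ** s v - _)]addrACA -opprD addrA subrK.
by rewrite !gactD gactN [RHS]addrA subrK.
Qed.
Next Obligation.
move=> u v w e e'; apply: val_inj; congr (_, _); apply: (@ext_j_inj _ _ _ X).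
rewrite /= !gact1 addr0 add0r !raddfD /= !sec_addP !sec_actP /= gact1 raddf0.
exact: sec_assoc_identity.
Qed.
Next Obligation.
move=> u e; apply: val_inj; congr (_, _); last by rewrite /= !mulg1.
apply: (@ext_j_inj _ _ _ X); rewrite /= !gact1 addr0 !raddfD /=.
rewrite sec_addP sec_unitP sec_actP /= gact1 raddf0.
by rewrite -[LHS]addrA [X in _ + X = _]addrA subrK addrK addNr.
Qed.
Next Obligation.
move=> u e; apply: val_inj; congr (_, _); last by rewrite /= !mulg1.
apply: (@ext_j_inj _ _ _ X); rewrite /= !gact1 add0r !raddfD /=.
rewrite sec_addP sec_unitP sec_actP /= gact1 raddf0.
by rewrite -[LHS]addrA [X in _ + X = _]addrA subrK [s u + _]addrC addrK addNr.
Qed.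
Next Obligation.
move=> u v; apply: val_inj; congr (_, _); apply: (@ext_j_inj _ _ _ X).
rewrite /= !gact1 add0r !raddfD /= !sec_addP sec_actP /= gact1.
by rewrite [LHS]addrA subrK [s u + _]addrC.
Qed.

Lemma reads_section : reads sec_smfun X.
Proof.
exists s; split=> // [u v|u t].
- by rewrite [fadd _ _ _]/= sec_addP subrK.
- by rewrite [fact _ _ _]/= sec_actP subrK.
Qed.

End SectionFunctor.

(** * Matching homotopy with equivalence of extensions *)

Lemma homotopicP (F F' : smfun) :
  homotopic F F' <-> exists h : Q -> B,
    [/\ forall u, fobj F u = d (h u) + fobj F' u,
        forall u v, h u + h v + fadd F' u v = fadd F u v + h (u + v)
      & forall u t, fact F u t + h (t ** u) = t ** h u + fact F' u t].
Proof.
split=> [[t]|[h [hd hadd hact]]].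
  (* Components have grade 1, so only their [B]-parts carry information. *)
  have [h tE] : exists h, forall u, sval (t u) = (h u, 1%g).
    exists (fun u => (sval (t u)).1) => u.
    by have /= <- := htp_gr t u; case: (sval _).
  exists h; split=> [u|u v|u r].
  - by have := xm_homP (t u); rewrite tE /= gact1.
  - have e : ggr (t u) = ggr (t v) by rewrite !htp_gr.
    have /(congr1 sval) := htp_tens e.
    by rewrite /= !gsm_tensE !tE /= !gact1 => -[].
  - have /(congr1 sval) := htp_nat t (dis_arrow u r).
    by rewrite /= !gfmapE !tE /= !gact1 => -[].
have hP u : 1%g ** fobj F u = d (h u) + fobj F' u by rewrite gact1 hd.
constructor; exists (fun u : gdis Q => XMHom (hP u)) => [//|u v m|u v e|].
- apply: val_inj; rewrite /= !gfmapE /= gact1 mul1g mulg1; congr (_, _).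
  have vE : v = (sval m).2 ** u by have /= -> := xm_homP m; rewrite add0r.
  by rewrite -hact -vE.
- by apply: val_inj; rewrite /= !gsm_tensE /= !gact1 hadd.
- apply: val_inj; rewrite /= !gsm_unitE /= gact1 mulg1; congr (_, _).
  (* The unit condition follows from additivity at [0, 0], as [funit = - fadd 0 0] for both
     functors. *)
  have := hadd 0 0; rewrite addr0 -addrA [RHS]addrC => /addrI h0.
  apply: (addIr (fadd F' 0 0)).
  by rewrite fadd0 -addrA h0 fadd0.
Qed.

(** A homotopy is a change of section. *)
Lemma reads_homotopic F F' X : homotopic F F' -> reads F X -> reads F' X.
Proof.
move=> /homotopicP[h [hd hadd hact]] [s [ps es sD sG]].
exists (fun u => s u - ext_j X (h u)); split=> [u|u|u v|u t].
- by rewrite raddfB /= ps ext_pj subr0.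
- by rewrite raddfB /= es ext_eps_j hd addrC addKr.
- rewrite addrACA -opprD sD -raddfD; apply: coboundary_shift.
  by rewrite -!raddfD hadd.
- rewrite gactD gactN sG -gactE; apply: coboundary_shift.
  by rewrite -!raddfD hact.
Qed.

(** Two sections of the same projection differ by a map into the image of [j]; its lift to [B] is
    the homotopy. *)
Lemma homotopic_reads F F' X : reads F X -> reads F' X -> homotopic F F'.
Proof.
move=> [s [ps es sD sG]] [s' [ps' es' sD' sG']]; apply/homotopicP.
have kerh u : exists b, ext_j X b = s u - s' u.
  by apply/ext_exact; rewrite raddfB /= ps ps' subrr.
pose h u := sval (cid (kerh u)).
have hE u : ext_j X (h u) = s u - s' u := svalP (cid (kerh u)).
exists h; split=> [u|u v|u t].
- by rewrite -(ext_eps_j X) hE raddfB /= es es' subrK.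
- apply: (@ext_j_inj _ _ _ X); rewrite !raddfD /= !hE addrACA -opprD sD sD'.
  by rewrite opprD [- _ - _]addrC addrA subrK addrA.
- apply: (@ext_j_inj _ _ _ X); rewrite !raddfD /= gactE !hE gactD gactN sG sG'.
  by rewrite opprD [- _ - _]addrC [in RHS]addrA subrK addrA.
Qed.

Lemma reads_equiv F X Y : ext_equiv X Y -> reads F X -> reads F Y.
Proof.
move=> [a [aj ap ae]] [s [ps es sD sG]]; exists (a \o s); split=> [u|u|u v|u t] /=.
- by rewrite ap ps.
- by rewrite ae es.
- by rewrite -raddfD sD raddfD /= aj.
- by rewrite -gactE sG raddfD /= aj.
Qed.

(** Each [e] is uniquely [j (r e) + s (p e)], and in these coordinates the sum and the action depend
    on [F] alone. Sending [j b + s u] to [j b + s' u] is therefore a homomorphism. *)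
Lemma equiv_reads F X Y : reads F X -> reads F Y -> ext_equiv X Y.
Proof.
move=> [s [ps es sD sG]] [s' [ps' es' sD' sG']].
have kerr e : exists b, ext_j X b = e - s (ext_p X e).
  by apply/ext_exact; rewrite raddfB /= ps subrr.
pose r e := sval (cid (kerr e)).
have rE e : ext_j X (r e) + s (ext_p X e) = e.
  by rewrite (svalP (cid (kerr e))) subrK.
have r_uniq b u : r (ext_j X b + s u) = b.
  have pbu : ext_p X (ext_j X b + s u) = u
    by rewrite raddfD /= ext_pj add0r ps.
  apply: (@ext_j_inj _ _ _ X); apply: (addIr (s u)).
  by rewrite -{2}pbu rE.
have rD x y : r (x + y) = r x + r y + fadd F (ext_p X x) (ext_p X y).
  by rewrite -{1}[x]rE -{1}[y]rE addrACA sD addrA -!raddfD r_uniq.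
have rG t x : r (t ** x) = t ** r x + fact F (ext_p X x) t.
  by rewrite -{1}[x]rE gactD sG addrA -gactE -raddfD r_uniq.
pose a e := ext_j Y (r e) + s' (ext_p X e).
have aD : {morph a : x y / x + y}.
  move=> x y; rewrite /a rD [in RHS]addrACA sD' addrA -!raddfD /=.
  by rewrite -[ext_p X (x + y)]/(ext_p X _) raddfD.
have aG t x : a (t ** x) = t ** a x.
  by rewrite /a rG gactD sG' -gactE addrA -raddfD gactE.
pose h1 := GRing.isZmodMorphism.Build _ _ a (zmod_of_add aD).
pose h2 := isEquivariant.Build G _ _ a aG.
pose h : {gmodhom _ -> _} := HB.pack a h1 h2.
exists h; split=> [b|e|e] /=.
(* Both sections take the value [j (fadd F 0 0)] at [0], so [j b] has first coordinate
   [b - fadd F 0 0], and the same correction is undone in [Y]. *)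
- have s0 (Z : extension M Q) (z : Q -> ext_E Z) :
      (forall u v, z u + z v = ext_j Z (fadd F u v) + z (u + v)) ->
      z 0 = ext_j Z (fadd F 0 0).
    by move=> /(_ 0 0); rewrite addr0 => /addIr.
  have := r_uniq (b - fadd F 0 0) 0.
  rewrite (s0 _ _ sD) -raddfD subrK /a => ->.
  by rewrite ext_pj (s0 _ _ sD') -raddfD subrK.
- by rewrite /a raddfD /= ext_pj add0r ps'.
- by rewrite /a -{3}[e]rE !raddfD /= !ext_eps_j es es'.
Qed.

End Cocycle.

Theorem theorem5p3 (G : groupType) (M : ab_xmod G) (Q : gmodType G)
    (psi : {gmodhom Q -> coker (xd M)}) :
  exists Omega : Hom_classes psi -> Ext_classes psi, bijective Omega.
Proof.
apply: (classes_bijection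
          (S := fun (F : fun_over psi) (X : ext_over psi) => reads (sval F) (sval X))).
- exact: fun_over_homotopicP.
- exact: ext_over_equivP.
- move=> [F Fpsi]; have FX := reads_twisted F.
  by exists (exist (fun X => ext_induces X psi) _ (proj1 (reads_induces psi FX) Fpsi)).
- move=> [X Xpsi]; pose s u := sval (cid (ext_p_surj X u)).
  have ps u : ext_p X (s u) = u := svalP (cid (ext_p_surj X u)).
  have FX := reads_section ps.
  by exists (exist (fun F => fun_induces psi F) _ (proj2 (reads_induces psi FX) Xpsi)).
(* A homotopy lets [F'] be read off both extensions; an equivalence lets both functors be read off
   [X]. *)
- move=> F F' X X' FX FX'; split=> [FF'|XX'].
    exact: equiv_reads (reads_homotopic FF' FX) FX'.
  exact: homotopic_reads FX (reads_equiv (ext_equiv_sym XX') FX').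
Qed.
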